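(* Let $\mathcal{G}=(V,E)$ be a finite tree with at least three vertices, with boundary $\delta\Omega$ (the set of vertices of degree one), such that $\deg(x)\le D$ for every $x\in V$, where $D$ is a positive integer. Then for every integer $k$ with $3\leq k\leq |\delta\Omega|$, the $k$-th Steklov eigenvalue $\lambda_k$ of $(\mathcal{G},\delta\Omega)$ satisfies $$\lambda_k\leq \frac{8(D-1)^2(k-1)}{|\delta\Omega|}.$$
   Context: Let $\mathcal{G}=(V,E)$ be a finite tree (simple, undirected, unweighted) with at least three vertices. Its boundary $\delta\Omega$ is the set of vertices of degree one and its interior is $\Omega=V\setminus\delta\Omega$; $|\cdot|$ denotes cardinality. The Steklov problem on $(\mathcal{G},\delta\Omega)$ is: for nonzero $f\in\mathbb{R}^V$ and $\lambda\in\mathbb{R}$, $\Delta f(x)=0$ for $x\in\Omega$ and $\frac{\partial f}{\partial n}(x)=\lambda f(x)$ for $x\in\delta\Omega$, where $(\Delta f)(x)=\sum_{y\sim x}(f(x)-f(y))$ and $\frac{\partial f}{\partial n}(x)=\sum_{y\in\Omega,\,y\sim x}(f(x)-f(y))$. The Steklov eigenvalues are the eigenvalues of the Dirichlet-to-Neumann operator on $\mathbb{R}^{\delta\Omega}$, $f\mapsto \frac{\partial\hat f}{\partial n}$, where $\hat f$ is the harmonic extension of $f$ ($\Delta\hat f=0$ on $\Omega$, $\hat f=f$ on $\delta\Omega$). This operator is self-adjoint and non-negative; its eigenvalues, counted with multiplicity, are ordered $0=\lambda_1\le\lambda_2\le\cdots\le\lambda_{|\delta\Omega|}$. *)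

(* Defs.v *)
From HB Require Import structures.
From mathcomp Require Import all_boot all_order all_algebra.
From mathcomp Require Import boolp classical_sets reals complex.

Set Implicit Arguments.
Unset Strict Implicit.
Unset Printing Implicit Defensive.

Import Order.TTheory GRing.Theory Num.Theory.

Local Open Scope ring_scope.

Section Graph.
Variables (T : finType) (e : rel T).

Definition simple_graph := symmetric e /\ irreflexive e.

(* [ucycle e c] is a closed walk through pairwise distinct vertices; in a
   simple graph those of size at most 2 are degenerate (the empty one, and the
   two ways of walking back and forth along an edge). *)
Definition acyclic := forall c : seq T, ucycle e c -> (size c <= 2)%N.

(* Nonemptiness is left to the cardinality hypotheses on T. *)
Definition tree :=
  [/\ simple_graph, (forall x y : T, connect e x y) & acyclic].

Definition degree (x : T) : nat := #|[set y | e x y]|.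

Definition boundary : {set T} := [set x | degree x == 1%N].

Definition graph_interior : {set T} := ~: boundary.

End Graph.

Section Steklov.
Variables (R : realType) (T : finType) (e : rel T).
Implicit Types (u g : {ffun T -> R}) (f : 'rV[R]_#|boundary e|).

Definition laplacian u (x : T) : R := \sum_(y | e x y) (u x - u y).

Definition normal_derivative u (x : T) : R :=
  \sum_(y in graph_interior e | e x y) (u x - u y).

(* R^(boundary e) is represented by row vectors, the i-th coordinate being the
   value at the i-th vertex [enum_val i] of the boundary. *)
Definition is_harmonic_extension f g :=
  (forall x, x \in graph_interior e -> laplacian g x = 0) /\
  (forall i, g (enum_val i) = f 0 i).

(* The unique g such that [is_harmonic_extension f g] (existence and
   uniqueness are [harmonic_extensionP] and [harmonic_extension_unique]). *)
Definition harmonic_extension f : {ffun T -> R} :=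
  xget 0 [set g | is_harmonic_extension f g]%classic.

Definition dtn f : 'rV[R]_#|boundary e| :=
  \row_i normal_derivative (harmonic_extension f) (enum_val i).

Definition dtn_mx : 'M[R]_#|boundary e| := lin1_mx dtn.

End Steklov.

(* The eigenvalues of A, listed in nondecreasing order and repeated according
   to their (algebraic) multiplicity, when the characteristic polynomial of A
   splits over R; see [spectrumP] for symmetric matrices. *)
Definition spectrum (R : realType) (n : nat) (A : 'M[R]_n) : seq R :=
  xget [::] [set s : seq R | sorted <=%R s /\
                char_poly A = \prod_(a <- s) ('X - a%:P)]%classic.

(* [steklov_eigenvalue R e k] is lambda_k, with k starting from 1. *)
Definition steklov_eigenvalue (R : realType) (T : finType) (e : rel T)
    (k : nat) : R := (spectrum (dtn_mx R e))`_k.-1.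

Section WellPosedness.
Variables (R : realType) (T : finType) (e : rel T).

Lemma weighted_green (w : rel T) (u v : T -> R) : symmetric w ->
  \sum_x u x * \sum_(y | w x y) (v x - v y) =
  \sum_x v x * \sum_(y | w x y) (u x - u y).
Proof.
move=> wC.
have H (a b : T -> R) : \sum_x a x * \sum_(y | w x y) (b x - b y) =
    \sum_x \sum_(y | w x y) a x * b x - \sum_x \sum_(y | w x y) a x * b y.
  rewrite -sumrB; apply: eq_bigr => x _; rewrite mulr_sumr -sumrB.
  by apply: eq_bigr => y _; rewrite mulrBr.
rewrite !H; congr (_ - _).
  by apply: eq_bigr => x _; apply: eq_bigr => y _; rewrite mulrC.
rewrite (exchange_big_dep predT) //=.
by apply: eq_bigr => x _; apply: eq_big => [y|y _]; rewrite 1?wC 1?mulrC.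
Qed.

Lemma dirichlet_energy (u : T -> R) : symmetric e ->
  (\sum_x u x * \sum_(y | e x y) (u x - u y)) *+ 2 =
  \sum_x \sum_(y | e x y) (u x - u y) ^+ 2.
Proof.
move=> eC; under eq_bigr => x _ do rewrite mulr_sumr.
rewrite mulr2n {2}(exchange_big_dep predT) //= -big_split /=.
apply: eq_bigr => x _.
have -> : \sum_(i | e i x) u i * (u i - u x) =
    \sum_(i | e x i) u i * (u i - u x).
  by apply: eq_bigl => i; rewrite eC.
rewrite -big_split; apply: eq_bigr => y _ /=.
by rewrite -(opprB (u x)) mulrN -mulrBl expr2.
Qed.

Hypothesis eC : symmetric e.
Hypothesis e_conn : forall x y : T, connect e x y.

Lemma harmonic_eq0 (g : {ffun T -> R}) (b : T) : b \in boundary e ->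
  (forall x, x \in graph_interior e -> laplacian e g x = 0) ->
  (forall x, x \in boundary e -> g x = 0) -> g = 0.
Proof.
move=> bB gI gB.
have := dirichlet_energy g eC.
rewrite [X in X *+ 2]big1 => [|x _]; last first.
  case: (boolP (x \in boundary e)) => xB; first by rewrite gB // mul0r.
  by rewrite [X in _ * X]gI ?mulr0 // inE.
rewrite mul0rn => /esym/eqP; rewrite psumr_eq0 => [/allP E0|x _]; last first.
  by apply: sumr_ge0 => y _; exact: sqr_ge0.
have gE x y : e x y -> g x = g y.
  move=> exy; have := E0 x; rewrite mem_index_enum => /(_ isT) /=.
  rewrite psumr_eq0 => [/allP/(_ y)|z _]; last exact: sqr_ge0.
  by rewrite mem_index_enum exy /= sqrf_eq0 subr_eq0 => /(_ isT)/eqP.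
apply/ffunP => x; rewrite ffunE -(gB b bB).
have /connectP[p + ->] := e_conn b x.
by elim: p b {bB} => //= y p IH b /andP[/gE -> /IH].
Qed.

Lemma harmonic_extension_unique (f : 'rV[R]_#|boundary e|) g1 g2 :
  boundary e != finset.set0 ->
  is_harmonic_extension f g1 -> is_harmonic_extension f g2 -> g1 = g2.
Proof.
case/set0Pn => b bB [I1 B1] [I2 B2]; apply/eqP; rewrite -subr_eq0.
apply/eqP/(harmonic_eq0 bB) => x xI.
  transitivity (laplacian e g1 x - laplacian e g2 x).
    rewrite /laplacian -sumrB; apply: eq_bigr => y _.
    by rewrite !ffunE opprD addrACA -opprD.
  by rewrite I1 // I2 // subrr.
by rewrite !ffunE -(enum_rankK_in xI xI) B1 B2 subrr.
Qed.

Lemma harmonic_extensionP (f : 'rV[R]_#|boundary e|) :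
  is_harmonic_extension f (harmonic_extension f).
Proof.
apply: (@xgetPex _ 0 [set g | is_harmonic_extension f g]%classic).
have [B0|/set0Pn[b bB]] := eqVneq (boundary e) finset.set0.
  exists 0; split=> [x _|i].
    by rewrite /laplacian big1 // => y _; rewrite !ffunE subrr.
  by have /setP/(_ (enum_val i)) := B0; rewrite enum_valP inE.
pose phi (g : {ffun T -> R^o}) : {ffun T -> R^o} :=
  [ffun x => if x \in boundary e then g x
            else laplacian e (g : {ffun T -> R}) x].
have phi_lin : linear phi.
  move=> a u v; apply/ffunP => x; rewrite !ffunE; case: ifP => // _.
  rewrite /laplacian scaler_sumr -big_split; apply: eq_bigr => y _ /=.
  by rewrite !ffunE scalerBr opprD addrACA.
pose phiL : {linear {ffun T -> R^o} -> {ffun T -> R^o}} :=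
  HB.pack phi (GRing.isLinear.Build _ _ _ _ phi phi_lin).
have ker0 : lker (linfun phiL) == 0%VS.
  apply/lker0P => u v; rewrite !lfunE /= => uv.
  apply/eqP; rewrite -subr_eq0; apply/eqP.
  have {uv} : phiL (u - v) = 0 by rewrite linearB /= uv subrr.
  move=> /ffunP H; apply/(harmonic_eq0 bB) => x xI.
    by have := H x; rewrite !ffunE; move: xI; rewrite inE => /negPf ->.
  by have := H x; rewrite [LHS]ffunE xI => ->; rewrite ffunE.
pose h : {ffun T -> R^o} :=
  [ffun x => if x \in boundary e then f 0 (enum_rank_in bB x) else 0].
exists ((linfun phiL)^-1%VF h).
have : phiL ((linfun phiL)^-1%VF h) = h by rewrite -lfunE lker0_lfunVK.
set g := (_ h); move=> /ffunP H; split=> [x|i].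
  by rewrite inE => /negPf xI; have := H x; rewrite !ffunE xI.
by have := H (enum_val i); rewrite !ffunE enum_valP enum_valK_in.
Qed.

Lemma dtn_mx_sym : (dtn_mx R e)^T = dtn_mx R e.
Proof.
apply/matrixP => i j; rewrite mxE !mxE.
pose w x y := e x y && ((x \in graph_interior e) || (y \in graph_interior e)).
have wC : symmetric w by move=> x y; rewrite /w eC orbC.
pose d i : {ffun T -> R} :=
  harmonic_extension (delta_mx 0 i : 'rV[R]_#|boundary e|).
suff H i1 i2 : \sum_x d i1 x * \sum_(y | w x y) (d i2 x - d i2 y) =
    normal_derivative e (d i2) (enum_val i1) by rewrite -!H weighted_green.
have [_ d1] := harmonic_extensionP (delta_mx 0 i1).
have [d2 _] := harmonic_extensionP (delta_mx 0 i2).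
rewrite (bigD1 (enum_val i1)) //= [X in _ + X]big1 => [|x xi].
  rewrite addr0 {1}/d d1 mxE !eqxx mul1r; apply: eq_bigl => y.
  by rewrite /w [enum_val i1 \in _]inE enum_valP /= andbC.
case: (boolP (x \in boundary e)) => xB.
  rewrite /d -(enum_rankK_in xB xB) d1 mxE eqxx /=; case: eqP => [E|_].
    by rewrite -E enum_rankK_in ?eqxx in xi.
  by rewrite mul0r.
have xI : x \in graph_interior e by rewrite inE.
rewrite (eq_bigl (e x)) => [|y]; last by rewrite /w xI andbT.
by rewrite [X in _ * X](d2 x xI) mulr0.
Qed.

End WellPosedness.

Lemma char_poly_conj (F : fieldType) n (P A : 'M[F]_n) : P \in unitmx ->
  char_poly (invmx P *m A *m P) = char_poly A.
Proof.
move=> Pu; rewrite /char_poly /char_poly_mx !map_mxM /=.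
set Q := map_mx polyC P; set Q' := map_mx polyC (invmx P).
have QQ : Q' *m Q = 1%:M by rewrite -map_mxM mulVmx // map_mx1.
have XE : Q' *m 'X%:M *m Q = 'X%:M.
  by rewrite -mulmxA mul_scalar_mx -scalemxAr QQ scalemx1.
rewrite -[in LHS]XE -mulmxBl -mulmxBr !det_mulmx mulrAC.
by rewrite -det_mulmx QQ det1 mul1r //.
Qed.

Lemma spectrumP (R : realType) (n : nat) (A : 'M[R]_n) : A^T = A ->
  sorted <=%R (spectrum A) /\
  char_poly A = \prod_(a <- spectrum A) ('X - a%:P).
Proof.
move=> AT; apply: (@xgetPex _ [::] [set s : seq R | sorted <=%R s /\
  char_poly A = \prod_(a <- s) ('X - a%:P)]%classic).
pose AC := map_mx (real_complex R) A.
have ACh : AC \is hermsymmx.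
  apply: realsym_hermsym.
    by apply/is_hermitianmxP; rewrite expr0 scale1r map_mx_id //;
    rewrite /AC map_trmx AT.
  by apply/mxOverP => i j; rewrite mxE complex_real.
have dR := hermitian_spectral_diag_real ACh.
have /orthomx_spectralP ACE := hermitian_normalmx ACh.
pose d i : R := complex.Re (spectral_diag AC 0 i).
exists (sort <=%R [seq d i | i <- enum 'I_n]); split.
  exact/sort_sorted/le_total.
rewrite (perm_big _ (permEl (perm_sort _ _))) big_map big_enum /=.
apply: (map_inj_poly (@complexI R) (rmorph0 _)).
rewrite map_char_poly -/AC ACE char_poly_conj ?spectral_unit //.
rewrite char_poly_trig ?diag_mx_is_trig // rmorph_prod.
apply: eq_bigr => i _; rewrite rmorphB /= map_polyX map_polyC /=.
rewrite mxE eqxx mulr1n; congr ('X - _%:P).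
by have /mxOverP/(_ 0 i)/RRe_real -> := dR.
Qed.

Lemma steklov_spectrumP (R : realType) (T : finType) (e : rel T) : tree e ->
  sorted <=%R (spectrum (dtn_mx R e)) /\
  char_poly (dtn_mx R e) = \prod_(a <- spectrum (dtn_mx R e)) ('X - a%:P).
Proof. by case=> -[eC _] e_conn _; exact/spectrumP/dtn_mx_sym. Qed.

Lemma size_steklov_spectrum (R : realType) (T : finType) (e : rel T) : tree e ->
  size (spectrum (dtn_mx R e)) = #|boundary e|.
Proof.
move=> /(steklov_spectrumP R)[_ /(congr1 (fun p : {poly R} => size p))].
by rewrite size_char_poly size_prod_XsubC => -[].
Qed.

(* Main.v *)
Require Import Defs.
From mathcomp Require Import all_boot all_order all_algebra.
From mathcomp Require Import reals complex zify ring lra.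

(** Write b for the number of leaves and d = D - 1. By the min-max principle,
    lambda_k is at most the largest Rayleigh quotient on any space of test
    functions of dimension at least k, and by the Dirichlet principle the
    energy of a harmonic extension may be replaced by that of any extension
    of the boundary data ([spectrum_le_rayleigh], [dirichlet_principle],
    [steklov_le_parts]). The test functions are constant on each part of a
    partition of the tree into connected parts, and vanish on all but at
    least k of these parts.

    The partition is greedy. Root the tree at a leaf r; then every other vertex
    has at most d children, and r has one. Going up from the bottom, cut the
    edge above a vertex as soon as the part hanging from that vertex has
    collected m leaves. Each part cut off has at least m leaves and, since none
    of the parts below its top had reached m, at most d(m-1) of them when
    m > 1. What remains around the root has at most m leaves. Hence the number
    K of parts cut off satisfies b <= K d(m-1) + m ([greedy_parts]).

    These K parts have at most K parts directly below them in total, so for at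
    least half of them there is at most one part directly below
    ([card_small_fibers]). Such a part meets at most two cut edges, and
    (x - y)^2 <= 2x^2 + 2y^2 on a cut edge gives a test function supported on
    these parts an energy of at most 4 times the sum of the squares of its
    values ([energy_parts_le]), while its boundary norm is at least m times
    that sum. So lambda_k <= 4/m as soon as K >= 2k - 1.

    Take m = ceil(b/q) with q = 2 d^2 (k-1): then 4/m <= 4q/b, which is the
    bound to be proved. If b <= q then m = 1, and the one-vertex parts
    given by the leaves already yield lambda_k <= 4. Otherwise m > 1 and
    (m-1) q < b, which with d >= 2 and k >= 3 makes K <= 2k - 1
    incompatible with the bound on b above. That d >= 2 comes from the same
    partition: for d <= 1 and m = 2 nothing is cut, so b <= 2 < k. *)

Set Implicit Arguments.
Unset Strict Implicit.
Unset Printing Implicit Defensive.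

Import Order.TTheory GRing.Theory Num.Theory.

Local Open Scope ring_scope.

(** * Min-max principle for real symmetric matrices *)

(** The cross terms of z = a + ib are purely imaginary, whether or not G is
    symmetric. *)
Lemma Re_quadratic_form (R : realType) (n : nat) (G : 'M[R]_n) (z : 'rV[R[i]]_n) :
  let: a := map_mx (@complex.Re R) z in let: b := map_mx (@complex.Im R) z in
  complex.Re ((z *m map_mx (real_complex R) G *m z ^t* ) 0 0)%sesqui =
  (a *m G *m a^T) 0 0 + (b *m G *m b^T) 0 0.
Proof.
have ReD : {morph (@complex.Re R) : x y / x + y} by case=> [? ?] [? ?].
rewrite !mxE (big_morph _ ReD (erefl _)) -big_split; apply: eq_bigr => j _ /=.
rewrite !mxE !mulr_suml (big_morph _ ReD (erefl _)) -big_split.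
apply: eq_bigr => i _ /=; rewrite !mxE.
case: (z 0 i) (z 0 j) => [x1 x2] [y1 y2] /=.
by rewrite !mulr0 subr0 add0r mulrN opprK.
Qed.

(** The min-max principle, for the test space spanned by the rows of U. If fewer
    than k eigenvalues were at most c, some nonzero combination of the rows of U
    would have no component along the corresponding eigenvectors, and its
    Rayleigh quotient would exceed c. The eigenbasis at hand is unitary over the
    complex numbers, so that the combination is complex; [Re_quadratic_form]
    extends the hypothesis on real combinations to it. *)
Lemma spectrum_le_rayleigh (R : realType) (n r k : nat) (A : 'M[R]_n)
    (U : 'M[R]_(r, n)) (c : R) : A^T = A -> (0 < k <= r)%N -> row_free U ->
  (forall v : 'rV_r, ((v *m U) *m A *m (v *m U)^T) 0 0
                     <= c * ((v *m U) *m (v *m U)^T) 0 0) ->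
  (spectrum A)`_k.-1 <= c.
Proof.
move=> AT /andP[k_gt0 kr] Ufree Ule.
have [s_sorted s_char] := spectrumP AT.
pose AC := map_mx (real_complex R) A.
pose UC := map_mx (real_complex R) U.
have ACh : AC \is hermsymmx.
  apply: realsym_hermsym.
    by apply/is_hermitianmxP; rewrite expr0 scale1r map_mx_id //;
    rewrite /AC map_trmx AT.
  by apply/mxOverP => i j; rewrite mxE complex_real.
have dR := hermitian_spectral_diag_real ACh.
have /orthomx_spectralP ACE := hermitian_normalmx ACh.
pose P := spectralmx AC.
have PU : P \is unitarymx by exact: spectral_unitarymx.
pose d i : R := complex.Re (spectral_diag AC 0 i).
have dE i : spectral_diag AC 0 i = real_complex R (d i).
  by have /mxOverP/(_ 0 i)/RRe_real -> := dR.
have sE : perm_eq (spectrum A) [seq d i | i <- enum 'I_n].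
  apply: prod_XsubC_eq; rewrite -s_char big_map big_enum /=.
  apply: (map_inj_poly (@complexI R) (rmorph0 _)).
  rewrite map_char_poly -/AC ACE char_poly_conj ?spectral_unit //.
  rewrite char_poly_trig ?diag_mx_is_trig // rmorph_prod.
  apply: eq_bigr => i _; rewrite rmorphB /= map_polyX map_polyC /=.
  by rewrite mxE eqxx mulr1n dE.
pose J := [set i | d i <= c].
suff kJ : (k <= #|J|)%N.
  apply: nth_count_le => //; rewrite prednK //.
  rewrite (permP sE) count_map -sum1_count big_enum_cond /=.
  apply: leq_trans kJ _; rewrite -sum1_card; apply: eq_leq.
  by apply: eq_bigl => i; rewrite inE.
rewrite leqNgt; apply/negP => Jk.
(* z *m M lists the components of z *m UC along the eigenvectors in J; M has
   too few columns to be row free. *)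
pose M : 'M[R[i]]_(r, #|J|) := colsub enum_val (UC *m P^t*)%sesqui.
have /rowV0Pn[z /sub_kermxP zM z0] : kermx M != 0.
  rewrite -mxrank_eq0 mxrank_ker subn_eq0 -ltnNge.
  by apply: leq_ltn_trans (rank_leq_col _) _; exact: leq_trans Jk kr.
pose y := (z *m UC *m P^t*)%sesqui.
have yJ i : i \in J -> y 0 i = 0.
  move=> iJ; have := congr1 (fun X : 'rV_#|J| => X 0 (enum_rank_in iJ i)) zM.
  rewrite [RHS]mxE /y -mulmxA => E0; rewrite mxE -[RHS]E0 [RHS]mxE.
  by apply: eq_bigr => j _; rewrite [in RHS]mxE enum_rankK_in.
have y0 : y != 0.
  apply: contraNneq z0 => y0; apply/eqP.
  have /(row_free_inj) : row_free UC by rewrite row_free_map.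
  apply; rewrite mul0mx.
  by rewrite -[LHS](mulmxKtV (z *m UC) PU) -?/y ?y0 ?mul0mx.
pose G := U *m A *m U^T - c *: (U *m U^T).
have Gle (v : 'rV_r) : (v *m G *m v^T) 0 0 <= 0.
  have -> : v *m G *m v^T = v *m U *m A *m (v *m U)^T -
      c *: (v *m U *m (v *m U)^T).
    by rewrite /G trmx_mul mulmxBr mulmxBl -scalemxAr -scalemxAl !mulmxA.
  by rewrite mxE [X in _ + X]mxE [X in _ - X]mxE subr_le0 Ule.
have := Re_quadratic_form G z.
suff E : (z *m map_mx (real_complex R) G *m z ^t* )%sesqui 0 0 =
    real_complex R (\sum_i (d i - c) * complex.Re (y 0 i * (y 0 i)^*)).
  rewrite {}E /= => E.
  have : 0 < \sum_i (d i - c) * complex.Re (y 0 i * (y 0 i)^*).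
    have N0 i : y 0 i != 0 -> 0 < (d i - c) * complex.Re (y 0 i * (y 0 i)^*).
      move=> yi; apply: mulr_gt0.
        rewrite subr_gt0 ltNge; apply: contraNN yi => iJ.
        by rewrite yJ // inE.
      by have := mul_conjC_gt0 (y 0 i); rewrite yi ltcE /= => /andP[].
    have /rV0Pn[i yi] := y0.
    rewrite (bigD1 i) //= ltr_wpDr ?N0 // sumr_ge0 // => j _.
    by have [->|/N0/ltW//] := eqVneq (y 0 j) 0; rewrite mul0r mulr0.
  by rewrite E ltNge => /negP; apply; rewrite -[leRHS]addr0 lerD.
have -> : (z *m map_mx (real_complex R) G *m z ^t*)%sesqui =
    (y *m (diag_mx (spectral_diag AC) - (real_complex R c)%:M) *m y^t*)%sesqui.
  have trM p q l (X : 'M[R[i]]_(p, q)) (Y : 'M_(q, l)) :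
      ((X *m Y)^t* = Y^t* *m X^t*)%sesqui by rewrite trmx_mul map_mxM.
  have UCt : (UC^t* = map_mx (real_complex R) U^T)%sesqui.
    by rewrite -map_trmx; apply/matrixP => i j; rewrite !mxE conj_Creal ?complex_real.
  have VE : invmx P = (P^t*)%sesqui by rewrite invmx_unitary.
  rewrite mulmxBr mulmxBl /y trM trmxCK -VE.
  have -> : z *m UC *m invmx P *m diag_mx (spectral_diag AC) *m
      (P *m (z *m UC)^t*)%sesqui = z *m UC *m AC *m ((z *m UC)^t*)%sesqui.
    by rewrite [in RHS]ACE !mulmxA.
  rewrite mul_mx_scalar -scalemxAl mulmxA mulmxKV ?spectral_unit //.
  rewrite trM UCt /G map_mxB map_mxZ !map_mxM /= -/UC -/AC.
  by rewrite mulmxBr mulmxBl -scalemxAr -scalemxAl !mulmxA.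
rewrite mxE rmorph_sum; apply: eq_bigr => i _.
have -> : (y *m (diag_mx (spectral_diag AC) - (real_complex R c)%:M)) 0 i =
    y 0 i * real_complex R (d i - c).
  rewrite mulmxBr mul_mx_diag mul_mx_scalar !mxE dE rmorphB mulrBr.
  by congr (_ - _); rewrite mulrC.
rewrite rmorphM /= RRe_real; last by rewrite -normCK realX.
by rewrite !mxE mulrAC mulrC.
Qed.

(** * Dirichlet principle and test functions *)

Section DirichletPrinciple.
Variables (R : realType) (T : finType) (e : rel T).
Hypotheses (eC : symmetric e) (e_conn : forall x y : T, connect e x y).
Hypothesis B0 : boundary e != finset.set0.

(** [dtn_mx] is defined from the values of [dtn] at the unit vectors only; this is
    the linearity of [dtn], which comes from the uniqueness of harmonic
    extensions. *)
Lemma mul_dtn_mx (f : 'rV[R]_#|boundary e|) : f *m dtn_mx R e = dtn f.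
Proof.
pose d i : {ffun T -> R} :=
  harmonic_extension (delta_mx 0 i : 'rV[R]_#|boundary e|).
have dP i : is_harmonic_extension (delta_mx 0 i) (d i).
  exact: harmonic_extensionP.
have fE : harmonic_extension f = [ffun x => \sum_i f 0 i * d i x].
  apply: (harmonic_extension_unique eC e_conn B0).
    exact: harmonic_extensionP.
  split=> [x xI|j].
    transitivity (\sum_i f 0 i * laplacian e (d i) x).
      rewrite /laplacian; under [RHS]eq_bigr => i _ do rewrite mulr_sumr.
      rewrite exchange_big; apply: eq_bigr => y _ /=.
      by rewrite !ffunE -sumrB; apply: eq_bigr => i _; rewrite mulrBr.
    rewrite big1 // => i _.
    by have [/(_ x xI) -> _] := dP i; rewrite mulr0.
  rewrite ffunE (bigD1 j) //= big1 ?addr0 => [|i ij].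
    by have [_ ->] := dP j; rewrite mxE !eqxx mulr1.
  have [_ ->] := dP i.
  by rewrite mxE eqxx eq_sym (negPf ij) mulr0.
apply/rowP => j; rewrite !mxE fE /normal_derivative.
under eq_bigr => i _ do rewrite !mxE mulr_sumr.
rewrite exchange_big; apply: eq_bigr => y _ /=.
by rewrite !ffunE -sumrB; apply: eq_bigr => i _; rewrite mulrBr.
Qed.

(** Writing u = g + h with g the harmonic extension of f, the cross term of the
    energy is the pairing of h with the Laplacian of g, and h vanishes exactly
    where that Laplacian need not. Edges between two boundary vertices, which
    [normal_derivative] ignores, can only increase the right-hand side. The
    factor 2 is there because the sum visits each edge twice. *)
Lemma dirichlet_principle (f : 'rV[R]_#|boundary e|) (u : T -> R) :
  (forall i, u (enum_val i) = f 0 i) ->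
  (f *m dtn_mx R e *m f^T) 0 0 *+ 2 <= \sum_x \sum_(y | e x y) (u x - u y) ^+ 2.
Proof.
move=> uf; rewrite mul_dtn_mx.
(* The graph without its edges inside the boundary: its Laplacian is the normal
   derivative on the boundary. *)
pose w x y := e x y && ((x \in graph_interior e) || (y \in graph_interior e)).
have wC : symmetric w by move=> x y; rewrite /w eC orbC.
pose g := harmonic_extension f.
have [gI gB] := harmonic_extensionP eC e_conn f; rewrite -/g in gI gB.
pose L x := \sum_(y | w x y) (g x - g y).
have LB x : x \in boundary e -> L x = normal_derivative e g x.
  by move=> xB; apply: eq_bigl => y; rewrite /w [x \in _]inE xB /= andbC.
have LI x : x \in graph_interior e -> L x = 0.
  move=> xI; rewrite -[RHS](gI x xI); apply: eq_bigl => y.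
  by rewrite /w xI andbT.
have LE (v : T -> R) : (forall i, v (enum_val i) = f 0 i) ->
    (dtn f *m f^T) 0 0 = \sum_x v x * L x.
  move=> vf; rewrite (bigID [in boundary e]) /= [X in _ + X]big1 => [|x xB].
    rewrite addr0 mxE [RHS]big_enum_val /=; apply: eq_bigr => i _.
    by rewrite !mxE vf LB ?enum_valP // mulrC.
  by rewrite LI ?mulr0 // inE.
pose h x := u x - g x.
have hL : \sum_x h x * L x = 0.
  under eq_bigr => x _ do rewrite mulrBl.
  by rewrite sumrB -!LE ?subrr.
have hg : \sum_x g x * \sum_(y | w x y) (h x - h y) = 0.
  by rewrite -(weighted_green h g wC).
apply: (@le_trans _ _ (\sum_x \sum_(y | w x y) (u x - u y) ^+ 2)); last first.
  apply: ler_sum => x _; rewrite big_mkcond [leRHS]big_mkcond /=.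
  apply: ler_sum => y _; rewrite /w; case: (e x y) => //=.
  by case: ifP => // _; exact: sqr_ge0.
rewrite (LE g) // dirichlet_energy // -subr_ge0.
suff -> : \sum_x \sum_(y | w x y) (u x - u y) ^+ 2 -
    \sum_x \sum_(y | w x y) (g x - g y) ^+ 2 =
    \sum_x \sum_(y | w x y) (h x - h y) ^+ 2.
  by apply: sumr_ge0 => x _; apply: sumr_ge0 => y _; exact: sqr_ge0.
rewrite -!dirichlet_energy // -mulrnBl; congr (_ *+ 2).
have uE x : u x = g x + h x by rewrite /h addrC subrK.
transitivity (\sum_x (g x + h x) * (L x + \sum_(y | w x y) (h x - h y)) -
    \sum_x g x * L x).
  congr (_ - _); apply: eq_bigr => x _; rewrite {1}uE; congr (_ * _).
  rewrite /L -big_split; apply: eq_bigr => y _ /=.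
  by rewrite !uE opprD addrACA.
under eq_bigr => x _ do rewrite mulrDl !mulrDr.
by rewrite !big_split /= hL hg !addr0 add0r addrAC subrr add0r.
Qed.

End DirichletPrinciple.

(** Test functions for [spectrum_le_rayleigh] of the form h o t, where t sends a
    vertex to the label of its part and h is supported on the set I of labels.
    Positivity of m in the lower bound on the boundary norm also makes these
    functions linearly independent on the boundary. *)
Lemma steklov_le_parts (R : realType) (T : finType) (e : rel T) (k : nat)
    (I : {set T}) (t : T -> T) (c m : R) : tree e ->
  (0 < k <= #|I|)%N -> 0 < m -> 0 <= c ->
  (forall h : T -> R, {in ~: I, forall x, h x = 0} ->
     \sum_x \sum_(y | e x y) (h (t x) - h (t y)) ^+ 2 <=
       (c * \sum_(x in I) h x ^+ 2) *+ 2) ->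
  (forall h : T -> R, {in ~: I, forall x, h x = 0} ->
     m * \sum_(x in I) h x ^+ 2 <= \sum_(x in boundary e) h (t x) ^+ 2) ->
  steklov_eigenvalue R e k <= c / m.
Proof.
move=> [[eC _] e_conn _] kI m_gt0 c_ge0 num den.
pose U : 'M[R]_(#|I|, #|boundary e|) :=
  \matrix_(i, j) (t (enum_val j) == enum_val i)%:R.
pose h (v : 'rV[R]_#|I|) x := \sum_i v 0 i * (x == enum_val i)%:R.
have hU v j : (v *m U) 0 j = h v (t (enum_val j)).
  by rewrite mxE; apply: eq_bigr => i _; rewrite mxE.
have hv v i : h v (enum_val i) = v 0 i.
  rewrite /h (bigD1 i) //= eqxx mulr1 big1 ?addr0 // => j ji.
  by rewrite (inj_eq enum_val_inj) eq_sym (negPf ji) mulr0.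
have hI v : {in ~: I, forall x, h v x = 0}.
  move=> x; rewrite inE => xI; rewrite /h big1 // => i _.
  by case: eqP => [xE|]; rewrite ?mulr0 //; rewrite xE enum_valP in xI.
have UU v : ((v *m U) *m (v *m U)^T) 0 0 =
    \sum_(x in boundary e) h v (t x) ^+ 2.
  rewrite mxE [RHS]big_enum_val /=; apply: eq_bigr => j _.
  by rewrite [X in _ * X]mxE !hU.
have vU (v : 'rV_#|I|) : v *m U = 0 -> v = 0.
  move=> vU0; have := den (h v) (hI v).
  rewrite -UU vU0 mul0mx mxE pmulr_rle0 // => s0.
  have : \sum_(x in I) h v x ^+ 2 == 0.
    by rewrite eq_le s0 sumr_ge0 // => x _; exact: sqr_ge0.
  rewrite psumr_eq0 => [/allP H|x _]; last exact: sqr_ge0.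
  apply/rowP => i; rewrite mxE -hv; apply/eqP.
  have := H (enum_val i); rewrite mem_index_enum enum_valP /= sqrf_eq0.
  exact.
have Ufree : row_free U.
  rewrite -kermx_eq0; apply/eqP/row_matrixP => i; rewrite row0.
  by apply: vU; rewrite -row_mul mulmx_ker row0.
have [k_gt0 kI'] := andP kI.
have I0 : (0 < #|I|)%N by exact: leq_trans kI'.
have B0 : boundary e != finset.set0.
  apply/eqP => B0; have [x xI] := card_gt0P I0.
  have := vU (const_mx 1); rewrite (_ : _ *m U = 0).
    move/(_ erefl)/rowP/(_ (enum_rank_in xI x)); rewrite !mxE => /eqP.
    by rewrite oner_eq0.
  apply/rowP => j; have /setP/(_ (enum_val j)) := B0.
  by rewrite enum_valP inE.
rewrite /steklov_eigenvalue; apply: (spectrum_le_rayleigh _ kI Ufree).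
  exact: dtn_mx_sym.
move=> v; rewrite UU.
apply: le_trans (_ : c * \sum_(x in I) h v x ^+ 2 <= _); last first.
  by rewrite -mulrA ler_wpM2l // ler_pdivlMl // den.
rewrite -(ler_pMn2r (n := 2)) //; apply: le_trans (num _ (hI v)).
by apply: dirichlet_principle => // j; rewrite hU.
Qed.

(** * Rooted trees *)

(** Here rk is the distance to the root r, and p x is the next vertex on a shortest
    path from x to r. An edge between x and y that joins neither of them to its
    parent would leave x and y connected, through r, by parent edges only, and
    so would close a cycle. *)
Lemma tree_parent (T : finType) (e : rel T) (r : T) : tree e ->
  exists (p : T -> T) (rk : T -> nat),
    (forall x, x != r -> e x (p x) /\ (rk (p x) < rk x)%N) /\
    (forall x y, e x y -> x != r /\ y = p x \/ y != r /\ x = p y).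
Proof.
move=> [[eC eI] e_conn e_acyc].
pose D x n := [exists s : n.-tuple T, path e x s && (last x s == r)].
have DP x : exists n, D x n.
  have /connectP[s sP sr] := e_conn x r.
  by exists (size s); apply/existsP; exists (in_tuple s); rewrite sP -sr eqxx.
pose rk x := ex_minn (DP x).
have rk_step x : x != r -> exists y, e x y && (rk y < rk x)%N.
  move=> xr; rewrite /rk; case: (ex_minnP (DP x)) => n /existsP[s0].
  move: (size_tuple s0); case: (tval s0) => [|y s] <- /=; first by rewrite (negPf xr).
  case/andP=> /andP[exy sP] sr _; exists y; rewrite exy /=.
  case: ex_minnP => m _; rewrite ltnS; apply.
  by apply/existsP; exists (in_tuple s); rewrite sP.
pose p x := odflt x [pick y | e x y && (rk y < rk x)%N].
have pP x : x != r -> e x (p x) /\ (rk (p x) < rk x)%N.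
  rewrite /p; case: pickP => [y /andP[] //|no /rk_step[y]].
  by rewrite no.
exists p, rk; split=> // x y exy.
have [|xy] := boolP ((x != r) && (y == p x)).
  by case/andP=> ? /eqP; left.
have [|yx] := boolP ((y != r) && (x == p y)).
  by case/andP=> ? /eqP; right.
(* The graph without the edge xy. *)
pose e' u v := e u v && ~~ ((u == x) && (v == y) || (u == y) && (v == x)).
have e'C : symmetric e'.
  move=> u v; rewrite /e' eC orbC; congr (_ && ~~ (_ || _)); exact: andbC.
have conn_r u : connect e' u r.
  have [n] := ubnP (rk u); elim: n u => // n IH u; rewrite ltnS => un.
  have [->|ur] := eqVneq u r; first exact: connect0.
  have [epu rku] := pP u ur.
  apply: connect_trans (IH _ (leq_trans rku un)).
  apply: connect1; rewrite /e' epu /=; apply/negP; case/orP.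
    by case/andP=> /eqP ux puy; rewrite -ux ur eq_sym puy in xy.
  by case/andP=> /eqP uy pux; rewrite -uy ur eq_sym pux in yx.
have : connect e' x y.
  apply: connect_trans (conn_r x) _.
  by rewrite (sym_connect_sym e'C).
case/connectP=> s0 s0P s0y; case/shortenP: s0P s0y => s sP s_uniq _ sy.
have := e_acyc (x :: s); rewrite /ucycle s_uniq andbT /= rcons_path -sy eC exy.
rewrite andbT (sub_path _ sP); last by move=> u v /andP[].
move=> /(_ isT).
case: s sP s_uniq sy => [|z [|? ?]] //=.
  by move=> _ _ yx'; rewrite yx' eI in exy.
by rewrite andbT => + _ zy; rewrite -zy /e' !eqxx /= andbF.
Qed.

(** The neighbours of v include its children and, unless v is the root, its parent,
    which is not one of its children as it has smaller rank. *)
Lemma tree_degree_child (T : finType) (e : rel T) (r : T) (p : T -> T)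
    (rk : T -> nat) : symmetric e ->
  (forall x, x != r -> e x (p x) /\ (rk (p x) < rk x)%N) ->
  forall v, (#|[set y | (y != r) && (p y == v)]| + (v != r) <= degree e v)%N.
Proof.
move=> eC pP v.
have sub : [set y | (y != r) && (p y == v)] \subset [set y | e v y].
  by apply/subsetP => y; rewrite !inE => /andP[/pP[+ _] /eqP <-]; rewrite eC.
have [vr|vr] := eqVneq v r; first by rewrite addn0 subset_leq_card.
rewrite addn1 /degree; apply: proper_card; apply/properP; split=> //.
have [evp rkp] := pP v vr.
exists (p v); rewrite !inE ?evp //; apply/negP => /andP[pr /eqP pp].
by have [_] := pP _ pr; rewrite pp ltnNge ltnW.
Qed.

(** * Greedy partition of a rooted tree *)

(** Recursion along a rank, with the equation as its specification: F may only look
    at values of smaller rank. *)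
Lemma rank_recursion (T A : Type) (a0 : A) (rk : T -> nat) (F : T -> (T -> A) -> A) :
  (forall x f g, (forall y, (rk y < rk x)%N -> f y = g y) -> F x f = F x g) ->
  exists f, forall x, f x = F x f.
Proof.
move=> Floc; pose f n := iter n (fun g x => F x g) (fun=> a0).
have fE n n' x : (rk x < n)%N -> (rk x < n')%N -> f n x = f n' x.
  elim: n n' x => // n IH [|n'] x // xn xn'; apply: Floc => y yx.
  by apply: IH; apply: leq_trans yx _.
exists (fun x => f (rk x).+1 x) => x.
by apply: Floc => y yx; apply: fE.
Qed.

Section GreedyPartition.
Variables (T : finType) (r : T) (p : T -> T) (rk : T -> nat).
Hypothesis rk_p : forall x, x != r -> (rk (p x) < rk x)%N.
Variables (B : {set T}) (m : nat).
Hypothesis m_gt0 : (0 < m)%N.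

(** W v is the number of leaves (elements of B) in the part hanging from v once
    the parts below v that have reached m leaves are cut off. The recursion
    goes up the tree, hence the reversed rank in the proof. *)
Lemma greedy_weight : exists W : T -> nat, forall v,
  W v = ((v \in B) + \sum_(y | (y != r) && (p y == v))
                        if (W y < m)%N then W y else 0)%N.
Proof.
pose N := \max_x rk x.
apply: (@rank_recursion T nat 0%N (fun x => N - rk x)%N
  (fun v W => ((v \in B) + \sum_(y | (y != r) && (p y == v))
                        if (W y < m)%N then W y else 0)%N)).
move=> v f g fg; congr (_ + _)%N; apply: eq_bigr => y /andP[yr /eqP pyv].
have yN : (rk y <= N)%N by exact: leq_bigmax.
by rewrite fg // ltn_sub2l // -pyv ?rk_p //; apply: leq_trans (rk_p yr) yN.
Qed.

Variable W : T -> nat.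
Hypothesis WE : forall v,
  W v = ((v \in B) + \sum_(y | (y != r) && (p y == v))
                        if (W y < m)%N then W y else 0)%N.

(** t x is the top of the part that contains x, the part around the root having r
    as its top. *)
Lemma greedy_top : exists t : T -> T, forall x,
  t x = if (x == r) || (m <= W x)%N then x else t (p x).
Proof.
apply: (@rank_recursion T T r rk (fun x t =>
  if (x == r) || (m <= W x)%N then x else t (p x))) => x f g fg.
by case: ifPn => //; rewrite negb_or => /andP[xr _]; rewrite fg ?rk_p.
Qed.

Variable t : T -> T.
Hypothesis tE : forall x, t x = if (x == r) || (m <= W x)%N then x else t (p x).

(** W v is indeed the number of leaves of the part with top v, here against an
    arbitrary weight h. Pair the equation defining W with h o t: the term of an
    uncut vertex y, in the part of its parent, appears once on each side and
    cancels, so that only the tops are left. *)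
Lemma sum_greedy_top (V : zmodType) (h : T -> V) :
  \sum_(x in B) h (t x) =
  \sum_(v | (v == r) || (m <= W v)%N) h v *+ W v.
Proof.
have : \sum_v h (t v) *+ W v = \sum_(x in B) h (t x) +
    \sum_(y | (y != r) && (W y < m)%N) h (t y) *+ W y.
  rewrite (big_mkcond [in B]) [X in _ + X]big_mkcondr /=.
  rewrite [X in _ + X](partition_big p predT) // -big_split; apply: eq_bigr => v _ /=.
  rewrite {1}WE mulrnDr; congr (_ + _); first by case: (v \in B).
  rewrite -sumrMnr; apply: eq_bigr => y /andP[yr /eqP pyv].
  case: ifP => // yW.
  by rewrite (tE y) (negPf yr) leqNgt yW /= pyv.
rewrite (bigID (fun v => (v == r) || (m <= W v)%N)) /=.
under [X in _ + X]eq_bigl do rewrite negb_or -ltnNge.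
move/addIr <-; apply: eq_bigr => v vS; by rewrite tE vS.
Qed.

Definition cut := [set x | (x != r) && (m <= W x)%N].

Variable d : nat.
Hypothesis leaf_child : forall v, v \in B -> v != r ->
  #|[set y | (y != r) && (p y == v)]| = 0%N.
Hypothesis inner_child : forall v, v != r ->
  (#|[set y | (y != r) && (p y == v)]| <= d)%N.
Hypothesis root_child : (#|[set y | (y != r) && (p y == r)]| <= 1)%N.

Let weight_le v :
  (W v <= (v \in B) + #|[set y | (y != r) && (p y == v)]| * m.-1)%N.
Proof.
rewrite WE leq_add2l -sum_nat_const.
rewrite (eq_bigl (fun y => y \in [set y | (y != r) && (p y == v)])); last first.
  by move=> y; rewrite inE.
apply: leq_sum => y _; case: ifP => // yW.
by rewrite -ltnS prednK.
Qed.

(** The parts hanging from the children that are not cut off have at most m - 1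
    leaves each; the 1 accounts for the case where v itself is a leaf. *)
Lemma greedy_weight_le v : v != r -> (W v <= maxn 1 (d * m.-1))%N.
Proof.
move=> vr; apply: leq_trans (weight_le v) _.
have [vB|vB] := boolP (v \in B); first by rewrite leaf_child // addn0 leq_maxl.
by rewrite add0n leq_max leq_mul2r inner_child ?orbT.
Qed.

(** The root is a leaf with one child, which contributes less than m when not cut
    off, so the part around it has at most m leaves. *)
Lemma greedy_mass : (#|B| <= #|cut| * maxn 1 (d * m.-1) + m)%N.
Proof.
have Wr : (W r <= m)%N.
  apply: leq_trans (weight_le r) _; rewrite -{2}(prednK m_gt0) -add1n.
  by rewrite leq_add ?leq_b1 // -{2}[m.-1]mul1n leq_mul2r root_child orbT.
have /eqP := sum_greedy_top (fun=> 1 : int).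
rewrite sumr_const sumrMnr eqr_nat => /eqP ->.
rewrite (bigD1 r) ?eqxx //= addnC leq_add // -sum_nat_const.
rewrite (eq_bigl [in cut]); first by apply: leq_sum => v; rewrite inE => /andP[/greedy_weight_le].
by move=> v; rewrite inE andbC; case: (v == r).
Qed.
End GreedyPartition.

(** The outcome of the greedy partition of a tree rooted at a leaf: C is the set of
    tops of the parts cut off, t sends a vertex to the top of its part, and W
    counts the leaves in each part. *)
Lemma greedy_parts (T : finType) (e : rel T) (r : T) (p : T -> T)
    (rk : T -> nat) (D m : nat) : symmetric e -> (0 < m)%N ->
  (forall x, degree e x <= D)%N -> r \in boundary e ->
  (forall x, x != r -> e x (p x) /\ (rk (p x) < rk x)%N) ->
  exists (C : {set T}) (t : T -> T) (W : T -> nat),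
  [/\ (forall y, y \in C -> [/\ y != r, t y = y &
         (m <= W y <= maxn 1 (D.-1 * m.-1))%N]),
      (forall y, y != r -> y \notin C -> t y = t (p y)),
      (#|boundary e| <= #|C| * maxn 1 (D.-1 * m.-1) + m)%N &
      (forall (R : realType) (h : T -> R), \sum_(x in boundary e) h (t x) =
        \sum_(v | (v == r) || (v \in C)) h v *+ W v)].
Proof.
move=> eC m_gt0 deg_le rB pP.
have rk_p x : x != r -> (rk (p x) < rk x)%N by move=> /pP[].
have child := tree_degree_child eC pP.
have leaf_child v : v \in boundary e -> v != r ->
    #|[set y | (y != r) && (p y == v)]| = 0%N.
  by move=> vB vr; have := child v; move: vB; rewrite inE vr => /eqP ->; lia.
have inner_child v : v != r -> (#|[set y | (y != r) && (p y == v)]| <= D.-1)%N.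
  by move=> vr; have := child v; have := deg_le v; rewrite vr; lia.
have [W WE] := greedy_weight rk_p (boundary e) m.
have [t tE] := greedy_top rk_p m W.
exists (cut r m W), t, W; split.
- move=> y; rewrite inE => /andP[yr yW]; split=> //.
    by rewrite tE yW orbT.
  by rewrite yW (greedy_weight_le m_gt0 WE leaf_child inner_child).
- by move=> y yr; rewrite inE yr /= [t y]tE (negPf yr) /= => /negPf ->.
- apply: (greedy_mass m_gt0 WE tE leaf_child inner_child).
  by have := child r; move: rB; rewrite inE eqxx => /eqP ->; rewrite addn0.
- move=> R h; rewrite (sum_greedy_top WE tE); apply: eq_bigl => v.
  by rewrite inE; case: (v == r).
Qed.

(** * Energy of functions constant on the parts *)

(** The fibers of f have at most #|C| elements of C altogether, so at most half of
    the elements of C have a fiber of size 2 or more. *)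
Lemma card_small_fibers (T : finType) (C : {set T}) (f : T -> T) :
  (#|C| <= 2 * #|[set v in C | (#|[set y in C | f y == v]| <= 1)%N]|)%N.
Proof.
set L := [set v in C | _]; pose n v := #|[set y in C | f y == v]|.
have nE : (\sum_v n v)%N = #|C|.
  rewrite -sum1_card [RHS](partition_big f predT) //=.
  by apply: eq_bigr => v _; rewrite /n -sum1_card; apply: eq_bigl => y; rewrite inE.
have LE v : (v \in L) = (v \in C) && (n v <= 1)%N by rewrite inE.
have : (2 * #|C :\: L| <= #|C|)%N.
  rewrite -nE mulnC -sum_nat_const [leqRHS](bigID [in C :\: L]) /=.
  rewrite -[leqLHS]addn0 leq_add // leq_sum // => v.
  by rewrite inE LE; case: (v \in C); rewrite ?andbF // -ltnNge => /andP[].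
have : (#|C :\: L| = #|C| - #|L|)%N.
  rewrite cardsD (finset.setIidPr _) //; apply/subsetP => v.
  by rewrite LE => /andP[].
lia.
Qed.

(** Every edge joins some y to its parent, and the double sum visits it twice. *)
Lemma energy_parent_le (R : realType) (T : finType) (e : rel T) (r : T)
    (p : T -> T) (u : T -> R) :
  (forall x y, e x y -> x != r /\ y = p x \/ y != r /\ x = p y) ->
  \sum_x \sum_(y | e x y) (u x - u y) ^+ 2 <=
    (\sum_(y | y != r) (u y - u (p y)) ^+ 2) *+ 2.
Proof.
move=> eP; pose F x y := (u x - u y) ^+ 2.
have F0 x y : 0 <= F x y by exact: sqr_ge0.
have FC x y : F x y = F y x by rewrite /F -sqrrN opprB.
have S1 : \sum_x \sum_y (if (x != r) && (y == p x) then F x y else 0) =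
    \sum_(y | y != r) F y (p y).
  rewrite [RHS]big_mkcond; apply: eq_bigr => x _.
  rewrite -big_mkcond; case: (x != r) => /=; last by rewrite big_pred0.
  by rewrite big_pred1_eq.
rewrite mulr2n -[leRHS]/(_ + \sum_(y | y != r) F y (p y)) -{2}S1 exchange_big /=.
rewrite -S1 -big_split; apply: ler_sum => x _ /=.
rewrite -big_split big_mkcond /=; apply: ler_sum => y _.
have [exy|_] := ifPn; last by rewrite addr_ge0 //; case: ifP.
case: (eP _ _ exy) => -[xr yE].
  by rewrite xr yE eqxx lerDl; case: ifP.
by rewrite xr yE eqxx [F y _]FC lerDr; case: ifP.
Qed.

(** Only the edges above the elements of C, the tops of the parts cut off, carry
    energy, and such an edge joins the part of y to that of p y. Each value of h
    on I then counts twice for the edge above its own part, and twice for the at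
    most one cut edge below. *)
Lemma energy_parts_le (R : realType) (T : finType) (e : rel T) (r : T)
    (p : T -> T) (C I : {set T}) (t : T -> T) (h : T -> R) :
  (forall x y, e x y -> x != r /\ y = p x \/ y != r /\ x = p y) ->
  (forall y, y \in C -> y != r /\ t y = y) ->
  (forall y, y != r -> y \notin C -> t y = t (p y)) ->
  {in I, forall v, (#|[set y in C | t (p y) == v]| <= 1)%N} ->
  {in ~: I, forall x, h x = 0} ->
  \sum_x \sum_(y | e x y) (h (t x) - h (t y)) ^+ 2 <=
    (4%:R * \sum_(x in I) h x ^+ 2) *+ 2.
Proof.
move=> eP CP NC I1 hI.
apply: le_trans (energy_parent_le (h \o t) eP) _; rewrite lerMn2r /=.
have hE : \sum_x h x ^+ 2 = \sum_(x in I) h x ^+ 2.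
  rewrite [LHS](bigID [in I]) /= [X in _ + X]big1 ?addr0 // => x xI.
  by rewrite hI ?inE // expr0n.
have -> : \sum_(y | y != r) (h (t y) - h (t (p y))) ^+ 2 =
    \sum_(y in C) (h y - h (t (p y))) ^+ 2.
  rewrite (bigID [in C]) /= [X in _ + X]big1 ?addr0 => [|y /andP[yr yC]].
    by apply: eq_big => [y|y /andP[_ /CP[_ ->]] //];
      case: (boolP (y \in C)) => [/CP[->]|]; rewrite ?andbF.
  by rewrite NC // subrr expr0n.
have S1 : \sum_(y in C) h y ^+ 2 <= \sum_(x in I) h x ^+ 2.
  rewrite -hE [leRHS](bigID [in C]) /= lerDl.
  by apply: sumr_ge0 => x _; exact: sqr_ge0.
have S2 : \sum_(y in C) h (t (p y)) ^+ 2 <= \sum_(x in I) h x ^+ 2.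
  rewrite (partition_big (t \o p) predT) //= -hE; apply: ler_sum => v _.
  rewrite (eq_bigr (fun=> h v ^+ 2)) => [|y /andP[_ /eqP <-]] //.
  have [vI|vI] := boolP (v \in I); last first.
    by rewrite hI ?inE // expr0n big1.
  rewrite (eq_bigl (fun y => y \in [set y in C | t (p y) == v])); last first.
    by move=> y; rewrite inE.
  rewrite sumr_const -[leRHS]mulr1n.
  by apply: ler_wpMn2l; [exact: sqr_ge0|exact: I1].
apply: (@le_trans _ _ (\sum_(y in C) (2 * h y ^+ 2 + 2 * h (t (p y)) ^+ 2))).
  by apply: ler_sum => y _; have := sqr_ge0 (h y + h (t (p y))); nra.
by rewrite big_split -!mulr_sumr /=; lra.
Qed.

(** * The eigenvalue bound *)

Theorem theorem1p5 (R : realType) (T : finType) (e : rel T) (D k : nat)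
    (e_tree : tree e) (T_ge3 : (3 <= #|T|)%N)
    (D_gt0 : (0 < D)%N) (deg_le_D : forall x : T, (degree e x <= D)%N)
    (k_ge3 : (3 <= k)%N) (k_le : (k <= #|boundary e|)%N) :
  steklov_eigenvalue R e k <=
    8%:R * (D%:R - 1) ^+ 2 * (k%:R - 1) / #|boundary e|%:R.
Proof.
pose b := #|boundary e|; pose d := D.-1; pose q := (2 * d ^ 2 * k.-1)%N.
have b_gt0 : (0 < b)%N by apply: leq_trans k_le; lia.
have [r rB] := card_gt0P b_gt0.
have eC : symmetric e by case: e_tree => -[].
have [p [rk [pP eP]]] := tree_parent r e_tree.
have child := tree_degree_child eC pP.
have d_ge2 : (2 <= d)%N.
  (* With m = 2 and d <= 1, no part other than the root's can reach m leaves. *)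
  have [C [t [W [CP _ bC _]]]] := greedy_parts eC (isT : 0 < 2)%N deg_le_D rB pP.
  rewrite leqNgt; apply/negP => d1; have C0 : #|C| = 0%N.
    apply/eqP; rewrite cards_eq0; apply/eqP/setP => y; rewrite inE.
    by apply/negP => /CP[_ _]; rewrite -/d; lia.
  by move: bC; rewrite C0; lia.
have -> : 8%:R * (D%:R - 1) ^+ 2 * (k%:R - 1) / #|boundary e|%:R =
    4%:R * q%:R / b%:R :> R.
  rewrite /q !natrM /d -!subn1 !natrB; [|lia..].
  congr (_ / _); ring.
suff [m [m_gt0 bqm le_m]] : exists m, [/\ (0 < m)%N, (b <= q * m)%N &
    steklov_eigenvalue R e k <= 4%:R / m%:R].
  apply: le_trans le_m _; rewrite -mulrA ler_pM2l //.
  rewrite -[leLHS]mul1r ler_pdivrMr ?ltr0n // mulrAC ler_pdivlMr ?ltr0n //.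
  by rewrite mul1r -natrM ler_nat.
have [bq|qb] := leqP b q.
  (* The parts are single vertices, and I is the boundary. *)
  exists 1%N; rewrite muln1; split=> //.
  apply: (@steklov_le_parts _ _ _ _ (boundary e) id) => //; first by lia.
  - move=> h hB; apply: (energy_parts_le (C := [set~ r]) (p := p)) => //.
    + exact: eP.
    + by move=> y; rewrite !inE.
    + by move=> y yr; rewrite !inE yr.
    + move=> v; rewrite inE => /eqP vB.
      have := child v; rewrite vB => cv; apply: leq_trans cv.
      apply: leq_trans (leq_addr _ _); apply: eq_leq; apply: eq_card => y.
      by rewrite !inE.
  - by move=> h hB; rewrite mul1r.
have q_gt0 : (0 < q)%N by rewrite /q !muln_gt0; lia.
(* The ceiling of b / q, at least 2 here. *)
pose m := (b.-1 %/ q).+1; exists m.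
have [C [t [W [CP NC bC tW]]]] := greedy_parts eC (isT : 0 < m)%N deg_le_D rB pP.
pose I := [set v in C | (#|[set y in C | t (p y) == v]| <= 1)%N].
have mq : (m.-1 * q < b)%N by have := leq_trunc_div b.-1 q; rewrite /m; lia.
have bqm : (b <= q * m)%N by have := ltn_ceil b.-1 q_gt0; rewrite /m mulnC; lia.
split=> //.
apply: (@steklov_le_parts _ _ _ _ I t) => //; rewrite ?ltr0n //.
- have := card_small_fibers C (t \o p).
  have kC : (2 * k <= #|C|)%N.
    rewrite leqNgt; apply/negP => Ck.
    have: (b < b)%N; last by rewrite ltnn.
    apply: leq_ltn_trans bC _; apply: leq_ltn_trans mq.
    have m_gt1 : (0 < m.-1)%N by rewrite /m /= divn_gt0 //; lia.
    have -> : maxn 1 (D.-1 * m.-1) = (d * m.-1)%N.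
      by apply/maxn_idPr; rewrite muln_gt0 m_gt1; lia.
    have -> : m = m.-1.+1 by [].
    move: (m.-1) m_gt1 => n n_gt0.
    (* (2k-1) d + 2 <= 2 d^2 (k-1) uses both d >= 2 and k >= 3. *)
    have dq : (#|C| * d + 2 <= q)%N.
      apply: (@leq_trans ((2 * k).-1 * d + 2)).
        by rewrite leq_add2r leq_mul2r; lia.
      rewrite /q -mulnn; nia.
    apply: leq_trans (leq_mul (leqnn n) dq); nia.
  by rewrite -/I; lia.
- move=> h hI; apply: (energy_parts_le (C := C) (p := p)) => //.
  + exact: eP.
  + by move=> y /CP[].
  + exact: NC.
  + by move=> v; rewrite inE => /andP[].
- move=> h hI; rewrite (tW R (fun x => h x ^+ 2)) mulr_sumr.
  rewrite big_mkcond [leRHS]big_mkcond; apply: ler_sum => v _ /=.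
  have h2 : 0 <= h v ^+ 2 by exact: sqr_ge0.
  rewrite inE; have [vC|vC] := boolP (v \in C); last first.
    by rewrite andFb; case: ifP => // _; rewrite mulrn_wge0.
  have [_ _ /andP[mW _]] := CP v vC.
  rewrite orbT andTb mulr_natl; case: ifP => _; last by rewrite mulrn_wge0.
  by rewrite ler_wpMn2l.
Qed.
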